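(* Let $n\geq 1$ be an integer, let $P_n=\langle a_0,\dots,a_k\rangle$ be the $n$-th $P$-sequence, and for each integer $s\geq 0$ let $F_{n,s}(x)=\sum_{i=0}^k a_i(i+x)^s$, a polynomial function over $\mathbb{R}$. Then for every integer $s\geq n$ the degree of $F_{n,s}$ equals $s-n$ (in particular $F_{n,n}$ is a nonzero constant).
   Context: Convention: $0^0=1$. $P$-sequences are defined recursively: $\langle 1,-1\rangle$ is a $P$-sequence; if $\langle a_0,\dots,a_k\rangle$ is a $P$-sequence with $a_0=-a_k$, then $\langle a_0,\dots,a_k,a_k,\dots,a_0\rangle$ is a $P$-sequence; if $\langle a_0,\dots,a_k\rangle$ is a $P$-sequence with $a_0=a_k$, then $\langle a_0,\dots,a_{k-1},0,-a_{k-1},\dots,-a_0\rangle$ is a $P$-sequence; and only sequences obtained by finitely many applications of these clauses are $P$-sequences. Ordering the $P$-sequences by increasing length, $P_n$ denotes the $n$-th one; thus $P_1=\langle 1,-1\rangle$, $P_2=\langle 1,-1,-1,1\rangle$, $P_3=\langle 1,-1,-1,0,1,1,-1\rangle$, and each $P_{n+1}$ is obtained from $P_n$ by whichever of the two clauses applies. *)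

(* Defs.v *)
From mathcomp Require Import all_boot all_order all_algebra.
From mathcomp Require Import reals.

Set Implicit Arguments.
Unset Strict Implicit.
Unset Printing Implicit Defensive.

Import Order.TTheory GRing.Theory Num.Theory.
Local Open Scope ring_scope.

(* In [Pseq_zero] the P-sequence <a_0, ..., a_k> is split as [rcons b c], with  *)
(* b = <a_0, ..., a_{k-1}> and c = a_k.                                         *)
Inductive Pseq : seq int -> Prop :=
| Pseq_init : Pseq [:: 1; -1]
| Pseq_mirror (a : seq int) :
    Pseq a -> head 0 a = - last 0 a -> Pseq (a ++ rev a)
| Pseq_zero (b : seq int) (c : int) :
    Pseq (rcons b c) -> head 0 (rcons b c) = c ->
    Pseq (b ++ 0 :: [seq - x | x <- rev b]).

(* [a] is the [n]-th P-sequence by increasing length, counting from 1: exactly  *)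
(* n - 1 P-sequences are strictly shorter. [nth_Pseq_unique] below shows that   *)
(* this determines [a] for every n >= 1.                                        *)
Definition nth_Pseq (n : nat) (a : seq int) : Prop :=
  Pseq a /\
  exists l : seq (seq int),
    [/\ uniq l, (size l).+1 = n
      & forall b, b \in l <-> Pseq b /\ (size b < size a)%N].

(* The convention 0 ^ 0 = 1 is built into [^+].                                 *)
Definition Fsum (R : realType) (a : seq int) (s : nat) (x : R) : R :=
  \sum_(i < size a) (a`_i)%:~R * (i%:R + x) ^+ s.

(* As [R] is infinite, [p] is determined by [f]; in particular the zero         *)
(* function has no degree.                                                      *)
Definition polyfun_degree (R : realType) (f : R -> R) (d : nat) : Prop :=
  exists p : {poly R}, (forall x, f x = p.[x]) /\ size p = d.+1.

Definition Pstep (a : seq int) : seq int :=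
  if head 0 a == - last 0 a then a ++ rev a
  else let b := take (size a).-1 a in b ++ 0 :: [seq - x | x <- rev b].

Definition Piter (m : nat) : seq int := iter m Pstep [:: 1; -1].

Lemma Piter_inv m :
  [/\ (1 < size (Piter m))%N, head 0 (Piter m) = 1
    & last 0 (Piter m) = 1 \/ last 0 (Piter m) = -1].
Proof.
elim: m => [|m]; first by split=> //; right.
rewrite /Piter iterS -/(Piter m); set a := Piter m; rewrite /Pstep.
move=> [sz h1 _]; case: a sz h1 => [//|x [//|y a]] /= _ ->.
case: eqP => _ /=.
  by split=> //; left; rewrite last_cat rev_cons last_rcons.
split=> //; first by rewrite size_cat addnS.
by right; rewrite last_cat /= rev_cons map_rcons last_rcons.
Qed.

Lemma Pseq_Piter m : Pseq (Piter m).
Proof.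
elim: m => [|m IH]; first exact: Pseq_init.
have [] := Piter_inv m; rewrite /Piter iterS -/(Piter m).
set a := Piter m in IH *; rewrite /Pstep => sz h1 hl.
case: eqP => [e|ne]; first exact: Pseq_mirror.
case/lastP: a IH sz h1 hl ne => // b c IH sz; rewrite last_rcons => h1 hl ne.
rewrite size_rcons /= -cats1 take_size_cat //.
apply: (Pseq_zero IH); rewrite h1.
by case: hl => hc; rewrite hc // in ne h1 *; case: ne; rewrite h1 opprK.
Qed.

Lemma Pseq_PiterP a : Pseq a -> exists m, a = Piter m.
Proof.
elim=> [|{}a _ [m ->] e|b c _ [m e] h]; first by exists 0%N.
  by exists m.+1; rewrite /Piter iterS -/(Piter m) /Pstep e eqxx.
exists m.+1; rewrite /Piter iterS -/(Piter m) /Pstep.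
have [_ h1 _] := Piter_inv m; rewrite -e in h1 *.
have hc : c = 1 by rewrite -h h1.
by rewrite h1 last_rcons hc /= size_rcons /= -cats1 take_size_cat.
Qed.

Lemma size_Piter_lt : {mono (fun m => size (Piter m)) : m p / (m < p)%N}.
Proof.
apply: leqW_mono; apply: leq_mono; apply: homo_ltn => [? ? ?|m].
  exact: ltn_trans.
have [] := Piter_inv m; rewrite [Piter m.+1]/Piter iterS -/(Piter m) /Pstep.
case: (Piter m) => // x a sz _ _; case: eqP => _.
  by rewrite size_cat size_rev -addn1 leq_add2l.
move: sz; rewrite /= size_cat /= size_map size_rev size_take /= ltnSn.
by move=> sz; rewrite addnS ltnS -[X in (X < _)%N]addn0 ltn_add2l.
Qed.

Lemma Piter_inj : injective Piter.
Proof.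
move=> m p e; apply/eqP; case: ltngtP => //; rewrite -size_Piter_lt e ltnn //.
Qed.

Lemma nth_PseqP (n : nat) (a : seq int) :
  nth_Pseq n a <-> (0 < n)%N /\ a = Piter n.-1.
Proof.
have memE m b : b \in [seq Piter i | i <- iota 0 m]
    <-> Pseq b /\ (size b < size (Piter m))%N.
  split=> [/mapP[i]|[/Pseq_PiterP[i ->]]].
    rewrite mem_iota /= add0n => lt_im ->; split; first exact: Pseq_Piter.
    by rewrite size_Piter_lt.
  by rewrite size_Piter_lt => lt_im; apply: map_f; rewrite mem_iota.
have uni m : uniq [seq Piter i | i <- iota 0 m].
  by rewrite map_inj_uniq ?iota_uniq //; exact: Piter_inj.
split=> [[/Pseq_PiterP[m ->] [l [ul <- lE]]]|[n0 ->]].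
  split=> //=; congr Piter.
  rewrite -[m in LHS](size_iota 0) -(size_map Piter); apply: perm_size.
  apply: uniq_perm => // b; apply/idP/idP => h.
    by apply/lE/memE.
  by apply/memE/lE.
split; first exact: Pseq_Piter.
exists [seq Piter i | i <- iota 0 n.-1]; split=> //.
by rewrite size_map size_iota prednK.
Qed.

Lemma nth_Pseq_unique (n : nat) : (1 <= n)%N -> exists! a, nth_Pseq n a.
Proof.
move=> n1; exists (Piter n.-1); split; first exact/nth_PseqP.
by move=> a /nth_PseqP[_ ->].
Qed.

Example nth_Pseq_3 : nth_Pseq 3 [:: 1; -1; -1; 0; 1; 1; -1].
Proof. exact/nth_PseqP. Qed.

(* Main.v *)
(* P_n is antisymmetric under reversal for n odd and symmetric for n even. So  *)
(* with k the length of P_n (n odd), or that length minus one (n even), P_(n+1) *)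
(* is P_n minus its own shift by k, i.e. F_(n+1,s)(x) = F_(n,s)(x) -            *)
(* F_(n,s)(x + k). In characteristic 0, a difference with nonzero step lowers   *)
(* the degree by exactly one, and F_(1,s)(x) = x^s - (x + 1)^s.                 *)

Require Import Defs.
From mathcomp Require Import all_boot all_order all_algebra.
From mathcomp Require Import reals.

Set Implicit Arguments.
Unset Strict Implicit.
Unset Printing Implicit Defensive.

Import Order.TTheory GRing.Theory Num.Theory.
Local Open Scope ring_scope.

(** Both clauses amount to subtracting a shifted copy ([Fsum_PiterS]), thanks to the reversal
    symmetry [rev_Piter]. Each such difference costs exactly one degree
    ([polyfun_degree_sub_shift]), so induction starting from x^s gives [Fsum_Piter_degree], and
    [nth_PseqP] carries it over to P_n. *)

Lemma polyfun_degree_sub_shift (R : realType) (f : R -> R) (c : R) d :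
  c != 0 -> polyfun_degree f d.+1 ->
  polyfun_degree (fun x => f x - f (x + c)) d.
Proof.
move=> c0 [p [fE sz]].
(* Taylor expansion of p(x + c) in powers of c: its order-0 term cancels p(x). *)
exists (- \sum_(i < d.+1) c ^+ i.+1 *: p^`N(i.+1)); split=> [x|].
  rewrite !fE (nderiv_taylor p (mulrC x c)) sz big_ord_recl nderivn0 expr0 mulr1.
  rewrite opprD addNKr hornerN horner_sum; congr (- _).
  by apply: eq_bigr => i _; rewrite hornerZ mulrC.
have coefN i j : (d < i + j)%N -> p^`N(i.+1)`_j = 0.
  by move=> ?; rewrite coef_nderivn nth_default ?mul0rn // sz addSn ltnS.
(* Only the term c p' reaches degree d, with coefficient c (d + 1) times the leading coefficient of
   p, nonzero in characteristic 0. *)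
have lead : (\sum_(i < d.+1) c ^+ i.+1 *: p^`N(i.+1))`_d != 0.
  rewrite coef_sum big_ord_recl big1 ?addr0 => [|i _]; last first.
    by rewrite coefZ coefN ?mulr0 // lift0 addSn ltnS leq_addl.
  rewrite coefZ coef_nderivn add1n bin1 expr1 mulf_neq0 // mulrn_eq0 /=.
  by rewrite -[d.+1]/(d.+2.-1) -sz -lead_coefE lead_coef_eq0 -size_poly_eq0 sz.
apply/eqP; rewrite size_polyN eqn_leq; apply/andP; split.
  apply/leq_sizeP => j dj; rewrite coef_sum big1 // => i _.
  by rewrite coefZ coefN ?mulr0 // (leq_trans dj) ?leq_addl.
by rewrite ltnNge; apply: contra lead => h; rewrite nth_default.
Qed.

Lemma Fsum_cat (R : realType) (a b : seq int) s (x : R) :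
  Fsum (a ++ b) s x = Fsum a s x + Fsum b s (x + (size a)%:R).
Proof.
rewrite /Fsum size_cat big_split_ord /=; congr (_ + _).
  by apply: eq_bigr => i _; rewrite nth_cat ltn_ord.
apply: eq_bigr => i _; rewrite nth_cat ltnNge leq_addr /= addKn natrD.
by rewrite [(size a)%:R + _]addrC -addrA [(size a)%:R + x]addrC.
Qed.

Lemma Fsum_opp (R : realType) (a : seq int) s (x : R) :
  Fsum [seq - y | y <- a] s x = - Fsum a s x.
Proof.
rewrite /Fsum size_map -sumrN; apply: eq_bigr => i _.
by rewrite (nth_map 0) // mulrNz mulNr.
Qed.

Lemma Fsum1 (R : realType) (c : int) s (x : R) :
  Fsum [:: c] s x = c%:~R * x ^+ s.
Proof. by rewrite /Fsum big_ord1 add0r. Qed.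

(** The end signs tell the two symmetries apart: mirroring gives a palindrome with both ends 1, the
    zero clause an antipalindrome with ends 1 and -1. *)
Lemma rev_Piter m :
  rev (Piter m) = if head 0 (Piter m) == - last 0 (Piter m)
                  then [seq - x | x <- Piter m] else Piter m.
Proof.
elim: m => [//|m]; have := Piter_inv m.
rewrite [Piter m.+1]/Piter iterS -/(Piter m) /Pstep.
set a := Piter m => -[sz h1 hl].
case: eqP => [e ra|ne ra].
  rewrite rev_cat revK; case: a sz h1 {hl e ra} => [//|x a] _ /= ->.
  by rewrite last_cat rev_cons last_rcons.
case/lastP: a sz h1 hl ne ra => // -[//|y b] c _ h1 _ _ _.
rewrite size_rcons -cats1 take_size_cat //; set d := y :: b.
have -> : rev (d ++ 0 :: [seq - x | x <- rev d])
    = [seq - x | x <- d ++ 0 :: [seq - x | x <- rev d]].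
  by rewrite rev_cat rev_cons -map_rev revK cat_rcons map_cat /= oppr0 (mapK opprK).
by rewrite last_cat /= rev_cons map_rcons last_rcons opprK eqxx.
Qed.

Lemma Fsum_PiterS (R : realType) m : exists2 k, (0 < k)%N &
  forall s (x : R), Fsum (Piter m.+1) s x
    = Fsum (Piter m) s x - Fsum (Piter m) s (x + k%:R).
Proof.
have := rev_Piter m; have [] := Piter_inv m.
rewrite [Piter m.+1]/Piter iterS -/(Piter m) /Pstep.
set a := Piter m => /= sz _ _; case: eqP => _ ra.
  by exists (size a); [exact: ltnW|move=> s x; rewrite Fsum_cat ra Fsum_opp].
case/lastP: a sz ra => // b c; rewrite size_rcons => sz ra.
(* The shift is one less than the length, so the two copies overlap in one place, where c - c yields
   the middle 0. *)
exists (size b) => // s x; rewrite /= -cats1 take_size_cat // !cats1.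
(* Reversing only the subtracted copy makes it start with c and continue with [rev b]. *)
rewrite -[in X in _ - X]ra rev_rcons -cat1s -[c :: _]cat1s -cats1 !Fsum_cat.
by rewrite Fsum_opp !Fsum1 mul0r add0r opprD addrA addrK.
Qed.

Lemma Fsum_Piter_degree (R : realType) m s :
  (m < s)%N -> polyfun_degree (@Fsum R (Piter m) s) (s - m.+1).
Proof.
elim: m s => [|m IH] s ms.
  (* P_1 is itself a difference, that of x^s with step 1. *)
  have [p [pE sz]] : polyfun_degree (fun x : R => x ^+ s - (x + 1) ^+ s) (s - 1).
    apply: (@polyfun_degree_sub_shift _ (fun x : R => x ^+ s)) => //.
      exact: oner_neq0.
    exists 'X^s; split=> [x|]; first by rewrite hornerXn.
    by rewrite size_polyXn subn1 prednK.
  exists p; split=> // x.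
  by rewrite -pE -[Piter 0]/([:: 1] ++ [:: -1]) Fsum_cat !Fsum1 mul1r mulN1r.
have [k k0 FE] := Fsum_PiterS R m.
have [||p [pE sz]] := @polyfun_degree_sub_shift R (Fsum (Piter m) s) k%:R (s - m.+2).
- by rewrite pnatr_eq0 -lt0n.
- by rewrite -subSn // subSS; apply: IH; exact: ltnW.
by exists p; split=> // x; rewrite FE.
Qed.

Theorem theorem1 (R : realType) (n : nat) (a : seq int)
  (hn : (1 <= n)%N) (ha : nth_Pseq n a) :
  (forall s : nat, (n <= s)%N -> polyfun_degree (@Fsum R a s) (s - n)) /\
  (exists c : R, c <> 0 /\ forall x : R, Fsum a n x = c).
Proof.
have deg s : (n <= s)%N -> polyfun_degree (@Fsum R a s) (s - n).
  have /nth_PseqP[_ ->] := ha.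
  by move=> ns; rewrite -{2}(prednK hn); apply: Fsum_Piter_degree; rewrite prednK.
split=> //; have [p [pE]] := deg n (leqnn n).
rewrite subnn => /eqP/size_poly1P[c /eqP c0 pc].
by exists c; split=> // x; rewrite pE pc hornerC.
Qed.
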